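(* Let $(R,\mathfrak m)$ be a noetherian, local, complete ring and let $X$ be an artinian $R$-module of Noetherian dimension $d$. Let $x_1,\dots,x_d\in\mathfrak m$ be such that $0:_X(x_1,\dots,x_d)R$ has finite length, and write $\underline x=x_1,\dots,x_d$. Then the local homology module $H^{\underline x}_d(X)$ is a finitely generated $R$-module.
   Context: All rings are commutative; ''complete'' means $\mathfrak m$-adically complete. For an artinian $R$-module $X$ and an ideal $J$ of $R$, $0:_XJ=\{u\in X: Ju=0\}$. Noetherian dimension: $\operatorname{N.dim}(0)=-1$; for $X\ne 0$, $\operatorname{N.dim}(X)$ is the least integer $r$ such that $0:_X(x_1,\dots,x_r)R$ has finite length for some $x_1,\dots,x_r\in\mathfrak m$. Local homology: for an artinian $R$-module $X$ and a sequence $\underline x=x_1,\dots,x_r$ in $\mathfrak m$, the $i$-th local homology module of $X$ with respect to $\underline x$ is $H^{\underline x}_i(X)=\varprojlim_{n\in\mathbb N}H_i(K_\bullet(x_1^n,\dots,x_r^n;X))$, where $K_\bullet(x_1^n,\dots,x_r^n;X)$ is the Koszul complex of $X$ with respect to $x_1^n,\dots,x_r^n$ and the limit is taken along the standard transition maps $K_\bullet(x_1^{n+1},\dots,x_r^{n+1};X)\to K_\bullet(x_1^n,\dots,x_r^n;X)$ (identity in degree $0$, and $e_{i}\mapsto x_{i}e_{i}$ on degree-one basis elements, extended multiplicatively). *)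

(* Defs.v *)
From HB Require Import structures.
From mathcomp Require Import all_boot all_order all_algebra.
From mathcomp Require Import boolp.

Set Implicit Arguments.
Unset Strict Implicit.
Unset Printing Implicit Defensive.

Import GRing.Theory.
Local Open Scope ring_scope.
Local Open Scope quotient_scope.

(* [submodClosed V] is the type of submodules of V.  They are bool-valued
   predicates; with the classical axioms of [boolp] these are all the
   submodules of V, up to [=i].  Ideals of R are submodules of R^o. *)

Section Submodules.
Variables (R : comNzRingType) (V : lmodType R).

Record submod (S : submodClosed V) := SubMod {
  submod_val :> V;
  _ : submod_val \in S
}.

HB.instance Definition _ (S : submodClosed V) :=
  [isSub for @submod_val S].
HB.instance Definition _ (S : submodClosed V) := [Choice of submod S by <:].
HB.instance Definition _ (S : submodClosed V) :=
  [SubChoice_isSubLmodule of submod S by <:].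

Definition lin_span k (v : 'I_k -> V) : {pred V} :=
  [pred w | `[< exists a : 'I_k -> R, w = \sum_(i < k) a i *: v i >]].

Lemma lin_span_submod_closed k (v : 'I_k -> V) : submod_closed (lin_span v).
Proof.
split.
  by apply/asboolP; exists (fun=> 0); rewrite big1 // => i _; rewrite scale0r.
move=> b u w /asboolP[c ->] /asboolP[e ->]; apply/asboolP.
exists (fun i => b * c i + e i); rewrite scaler_sumr -big_split /=.
by apply: eq_bigr => i _; rewrite scalerDl scalerA.
Qed.
HB.instance Definition _ k (v : 'I_k -> V) :=
  GRing.isSubmodClosed.Build R V (lin_span v) (lin_span_submod_closed v).

(* 0 :_V J *)
Definition annihilated (J : {pred R}) : {pred V} :=
  [pred u | `[< forall a, a \in J -> a *: u = 0 >]].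

Lemma annihilated_submod_closed J : submod_closed (annihilated J).
Proof.
split; first by apply/asboolP => a _; rewrite scaler0.
move=> b u w /asboolP hu /asboolP hw; apply/asboolP => a aJ.
by rewrite scalerDr (hw _ aJ) scalerA mulrC -scalerA hu // scaler0 addr0.
Qed.
HB.instance Definition _ J :=
  GRing.isSubmodClosed.Build R V (annihilated J) (annihilated_submod_closed J).

Definition finitely_generated : Prop :=
  exists k (v : 'I_k -> V), forall w, w \in lin_span v.

Definition noetherian_module : Prop :=
  forall M : nat -> submodClosed V, (forall n, {subset M n <= M n.+1}) ->
  exists N, forall n, (N <= n)%N -> M n =i M N.

Definition artinian_module : Prop :=
  forall M : nat -> submodClosed V, (forall n, {subset M n.+1 <= M n}) ->
  exists N, forall n, (N <= n)%N -> M n =i M N.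

(* N has a composition series 0 = M 0 < M 1 < ... < M k = N. *)
Definition finite_length (N : {pred V}) : Prop :=
  exists k (M : nat -> submodClosed V),
    [/\ M 0 =i pred1 0, M k =i N &
        forall i, (i < k)%N ->
          [/\ {subset M i <= M i.+1}, ~ M i =i M i.+1 &
              forall L : submodClosed V,
                {subset M i <= L} -> {subset L <= M i.+1} ->
                L =i M i \/ L =i M i.+1]].

End Submodules.
Arguments annihilated {R} V J.

Section QuotientModule.
Variables (R : comNzRingType) (V : lmodType R) (S : submodClosed V).

(* [submodClosed] does not carry closure under opposite, which [quot] needs. *)
Definition zmod_of_submod : {pred V} := S.
HB.instance Definition _ :=
  GRing.isSubmodClosed.Build R V zmod_of_submod (submodClosedP S).

Definition quotmod : Type := Quotient.quot zmod_of_submod.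

HB.instance Definition _ := Choice.on quotmod.
HB.instance Definition _ := EqQuotient.on quotmod.
HB.instance Definition _ := GRing.Zmodule.on quotmod.

Lemma quotmod_eqP (u v : V) :
  reflect (\pi_quotmod u = \pi_quotmod v) (u - v \in S).
Proof. by rewrite -[_ \in S]/(_ \in zmod_of_submod) Quotient.idealrBE; exact: eqP. Qed.

Lemma quotmod_piD (u v : V) :
  \pi_quotmod (u + v) = \pi_quotmod u + \pi_quotmod v.
Proof. exact: (raddfD (\pi_(Quotient.quot zmod_of_submod))). Qed.

Definition quotmod_scale (a : R) (z : quotmod) : quotmod :=
  \pi_quotmod (a *: repr z).

Lemma quotmod_piZ a (u : V) :
  quotmod_scale a (\pi_quotmod u) = \pi_quotmod (a *: u).
Proof.
apply/quotmod_eqP; rewrite -scalerBr rpredZ //.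
by apply/quotmod_eqP; rewrite reprK.
Qed.

Fact quotmod_scaleA a b z :
  quotmod_scale a (quotmod_scale b z) = quotmod_scale (a * b) z.
Proof.
by rewrite -[z]reprK (quotmod_piZ b) (quotmod_piZ a) (quotmod_piZ (a * b)) scalerA.
Qed.
Fact quotmod_scale1 : left_id 1 quotmod_scale.
Proof. by move=> u; rewrite -[u]reprK quotmod_piZ scale1r. Qed.
Fact quotmod_scaleDr : right_distributive quotmod_scale +%R.
Proof.
move=> a u v; rewrite -[u]reprK -[v]reprK.
by rewrite -quotmod_piD (quotmod_piZ a (_ + _)) (quotmod_piZ a (repr u))
  (quotmod_piZ a (repr v)) scalerDr quotmod_piD.
Qed.
Fact quotmod_scaleDl z : {morph quotmod_scale^~ z : a b / a + b}.
Proof.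
by move=> a b; rewrite -[z]reprK (quotmod_piZ (a + b)) (quotmod_piZ a) (quotmod_piZ b)
  scalerDl quotmod_piD.
Qed.

HB.instance Definition _ := GRing.Zmodule_isLmodule.Build R quotmod
  quotmod_scaleA quotmod_scale1 quotmod_scaleDr quotmod_scaleDl.

Definition quotmod_pi (u : V) : quotmod := \pi_quotmod u.

Lemma quotmod_pi_is_linear : linear quotmod_pi.
Proof. by move=> a u v; rewrite /quotmod_pi quotmod_piD -quotmod_piZ. Qed.
HB.instance Definition _ :=
  GRing.isLinear.Build R V quotmod *:%R quotmod_pi quotmod_pi_is_linear.

End QuotientModule.

Section InverseLimit.
Variables (R : comNzRingType) (V : nat -> lmodType R).
Variable f : forall n, {linear V n.+1 -> V n}.

Definition dprod : Type := forall n, V n.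
HB.instance Definition _ := Choice.on dprod.

Let add (u v : dprod) : dprod := fun n => u n + v n.
Let opp (u : dprod) : dprod := fun n => - u n.
Let scale (a : R) (u : dprod) : dprod := fun n => a *: u n.

Fact dprod_addA : associative add.
Proof. by move=> u v w; apply: functional_extensionality_dep => n; apply: addrA. Qed.
Fact dprod_addC : commutative add.
Proof. by move=> u v; apply: functional_extensionality_dep => n; apply: addrC. Qed.
Fact dprod_add0 : left_id (fun n => 0) add.
Proof. by move=> u; apply: functional_extensionality_dep => n; apply: add0r. Qed.
Fact dprod_addN : left_inverse (fun n => 0) opp add.
Proof. by move=> u; apply: functional_extensionality_dep => n; apply: addNr. Qed.
HB.instance Definition _ :=
  GRing.isZmodule.Build dprod dprod_addA dprod_addC dprod_add0 dprod_addN.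

Fact dprod_scaleA a b u : scale a (scale b u) = scale (a * b) u.
Proof. by apply: functional_extensionality_dep => n; apply: scalerA. Qed.
Fact dprod_scale1 : left_id 1 scale.
Proof. by move=> u; apply: functional_extensionality_dep => n; apply: scale1r. Qed.
Fact dprod_scaleDr : right_distributive scale +%R.
Proof. by move=> a u v; apply: functional_extensionality_dep => n; apply: scalerDr. Qed.
Fact dprod_scaleDl u : {morph scale^~ u : a b / a + b}.
Proof. by move=> a b; apply: functional_extensionality_dep => n; apply: scalerDl. Qed.
HB.instance Definition _ := GRing.Zmodule_isLmodule.Build R dprod
  dprod_scaleA dprod_scale1 dprod_scaleDr dprod_scaleDl.

Definition compatible : {pred dprod} :=
  [pred u | `[< forall n, f n (u n.+1) = u n >]].

Lemma compatible_submod_closed : submod_closed compatible.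
Proof.
split; first by apply/asboolP => n; exact: raddf0.
move=> a u v /asboolP hu /asboolP hv; apply/asboolP => n.
by rewrite [LHS]linearP hu hv.
Qed.
HB.instance Definition _ :=
  GRing.isSubmodClosed.Build R dprod compatible compatible_submod_closed.

Definition invlim := submod compatible.
HB.instance Definition _ := GRing.Lmodule.on invlim.

End InverseLimit.

Definition ideal_gen (R : comNzRingType) r (x : 'I_r -> R) : {pred R} :=
  lin_span (x : 'I_r -> R^o).

Section LocalRing.
Variables (R : comNzRingType) (m : submodClosed R^o).

Definition maximal_ideal (I : submodClosed R^o) : Prop :=
  1 \notin I /\
  forall J : submodClosed R^o, {subset I <= J} -> 1 \notin J -> J =i I.

Definition local_ring : Prop :=
  maximal_ideal m /\ forall I : submodClosed R^o, maximal_ideal I -> I =i m.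

Definition noetherian_ring : Prop := noetherian_module R^o.

(* m ^ n; the coefficients b j make m ^ 0 the unit ideal. *)
Definition ideal_pow (n : nat) : {pred R} :=
  [pred a | `[< exists k (b : 'I_k -> R) (c : 'I_k -> 'I_n -> R),
    (forall j i, c j i \in m) /\ a = \sum_(j < k) b j * \prod_(i < n) c j i >]].

(* The canonical map from R to the inverse limit of the R / m ^ n is
   injective and surjective. *)
Definition adic_complete : Prop :=
  (forall a : R, (forall n, a \in ideal_pow n) -> a = 0) /\
  (forall a : nat -> R, (forall n, a n.+1 - a n \in ideal_pow n) ->
     exists b : R, forall n, b - a n \in ideal_pow n).

Definition noetherian_dim (X : lmodType R) (d : int) : Prop :=
  ((forall u : X, u = 0) /\ d = -1) \/
  ((exists u : X, u <> 0) /\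
   exists r : nat, [/\ d = r%:Z,
     exists2 x : 'I_r -> R, (forall i, x i \in m) &
       finite_length (annihilated X (ideal_gen x)) &
     forall (s : nat) (x : 'I_s -> R), (forall i, x i \in m) ->
       finite_length (annihilated X (ideal_gen x)) -> (r <= s)%N]).

End LocalRing.

Section Koszul.
Variables (R : comNzRingType) (X : lmodType R) (r : nat).

(* A chain c stands for the sum over all s of c s e_s, where
   e_s = e_{i_1} /\ ... /\ e_{i_p} for s = {i_1 < ... < i_p}. *)
Definition koszul := {ffun {set 'I_r} -> X}.
HB.instance Definition _ := GRing.Lmodule.on koszul.

Definition koszul_degree (p : nat) : {pred koszul} :=
  [pred c : koszul | [forall s : {set 'I_r}, (c s != 0) ==> (#|s| == p)]].

(* d (e_{i_1} /\ ... /\ e_{i_p}) =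
     \sum_k (-1) ^ (k - 1) x_{i_k} e_{i_1} /\ ..^.. /\ e_{i_p},
   so the coefficient of e_t collects the e_(i |: t) with i \notin t. *)
Definition koszul_diff (x : 'I_r -> R) (c : koszul) : koszul :=
  [ffun t : {set 'I_r} => \sum_(i | i \notin t)
     ((-1) ^+ #|[set j in t | (j < i)%N]| * x i) *: c (i |: t)].

Lemma koszul_diff_is_linear x : linear (koszul_diff x).
Proof.
move=> a c e; apply/ffunP => t; rewrite !ffunE scaler_sumr -big_split /=.
apply: eq_bigr => i _; rewrite !ffunE scalerDr; congr (_ + _).
by rewrite !scalerA mulrC.
Qed.
HB.instance Definition _ x := GRing.isLinear.Build R koszul koszul *:%R
  (koszul_diff x) (koszul_diff_is_linear x).

Lemma koszul_degree_submod_closed p : submod_closed (koszul_degree p).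
Proof.
split; first by apply/forallP => s; rewrite ffunE eqxx.
move=> a c e /forallP hc /forallP he; apply/forallP => s; rewrite !ffunE.
have [_|np] := boolP (#|s| == p); first by rewrite implybT.
move: (hc s) (he s); rewrite (negbTE np) !implybF !negbK => /eqP-> /eqP->.
by rewrite scaler0 addr0 eqxx.
Qed.
HB.instance Definition _ p := GRing.isSubmodClosed.Build R koszul
  (koszul_degree p) (koszul_degree_submod_closed p).

Lemma koszul_diffK x c : koszul_diff x (koszul_diff x c) = 0.
Proof.
apply/ffunP => t; rewrite !ffunE.
pose s (t : {set 'I_r}) (i : 'I_r) : R :=
  (-1) ^+ #|[set j in t | (j < i)%N]| * x i.
pose F i j := (s t i * s (i |: t) j) *: c (j |: (i |: t)).
have FN i j : i \notin t -> j \notin t -> (i < j)%N -> F i j = - F j i.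
  move=> it jt ij; rewrite /F setUCA -scaleNr; congr (_ *: _).
  have -> : s (i |: t) j = - s t j.
    rewrite /s; apply: (etrans (y := (-1) ^+ #|[set k in t | (k < j)%N]|.+1 * x j));
      last by rewrite exprS mulN1r mulNr.
    congr (_ ^+ _ * _).
    have -> : [set k in i |: t | (k < j)%N] = i |: [set k in t | (k < j)%N].
      by apply/setP => k; rewrite !inE andb_orl; case: eqP => // ->; rewrite ij.
    by rewrite cardsU1 inE (negbTE it).
  have -> : s (j |: t) i = s t i.
    congr ((-1) ^+ _ * _); apply: eq_card => k; rewrite !inE.
    by case: eqP => // ->; rewrite ltnNge (ltnW ij) !andbF.
  by rewrite mulrN mulrC.
transitivity (\sum_(i | i \notin t) \sum_(j | (j \notin t) && (j != i)) F i j).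
  apply: eq_bigr => i it; rewrite ffunE scaler_sumr.
  by apply: eq_big => [j|j _]; rewrite ?inE ?negb_or 1?andbC // scalerA.
transitivity (\sum_(i | i \notin t) \sum_(j | (j \notin t) && (i < j)%N) F i j +
              \sum_(i | i \notin t) \sum_(j | (j \notin t) && (j < i)%N) F i j).
  rewrite -big_split; apply: eq_bigr => i it /=.
  rewrite (bigID (fun j : 'I_r => (i < j)%N)) /=.
  congr (_ + _); apply: eq_bigl => j; rewrite -andbA; congr (_ && _).
    by rewrite -(inj_eq val_inj) /= neq_ltn; case: ltngtP.
  by rewrite -(inj_eq val_inj) /= neq_ltn; case: ltngtP.
rewrite [X in X + _](_ : _ =
  \sum_(i | i \notin t) \sum_(j | (j \notin t) && (i < j)%N) - F j i); last first.
  by apply: eq_bigr => i it; apply: eq_bigr => j /andP[jt ij]; exact: FN.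
rewrite [X in X + _](exchange_big_dep (fun j => j \notin t)) /=; last first.
  by move=> i j _ /andP[].
rewrite -big_split big1 //= => j jt; rewrite -[RHS](subrr
  (\sum_(i | (i \notin t) && (i < j)%N) F j i)) addrC -sumrN; congr (_ + _).
by apply: eq_bigl => i; rewrite jt.
Qed.

Lemma koszul_diff_degree x p c :
  c \in koszul_degree p.+1 -> koszul_diff x c \in koszul_degree p.
Proof.
move=> /forallP hc; apply/forallP => t; apply/implyP; rewrite ffunE.
apply: contraNT => tp; rewrite big1 // => i it.
have := hc (i |: t); rewrite cardsU1 it eqSS (negbTE tp) implybF negbK.
by move=> /eqP->; rewrite scaler0.
Qed.

Definition koszul_cycle x p : {pred koszul} :=
  [pred c | (c \in koszul_degree p) && (koszul_diff x c == 0)].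

Lemma koszul_cycle_submod_closed x p : submod_closed (koszul_cycle x p).
Proof.
split; first by rewrite inE rpred0 raddf0 eqxx.
move=> a c e /andP[hc /eqP dc] /andP[he /eqP de].
by rewrite inE rpredD ?rpredZ //= linearP /= dc de scaler0 addr0.
Qed.
HB.instance Definition _ x p := GRing.isSubmodClosed.Build R koszul
  (koszul_cycle x p) (koszul_cycle_submod_closed x p).

Definition koszul_boundary x p : {pred submod (koszul_cycle x p)} :=
  [pred z | `[< exists2 b, b \in koszul_degree p.+1 &
                           koszul_diff x b = val z >]].
Arguments koszul_boundary : clear implicits.

Lemma koszul_boundary_submod_closed x p : submod_closed (koszul_boundary x p).
Proof.
split; first by apply/asboolP; exists 0; rewrite ?rpred0 // !raddf0.
move=> a u v /asboolP[b hb db] /asboolP[e he de]; apply/asboolP.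
by exists (a *: b + e); rewrite ?rpredD ?rpredZ // !linearP /= db de.
Qed.
HB.instance Definition _ x p := GRing.isSubmodClosed.Build R
  (submod (koszul_cycle x p)) (koszul_boundary x p)
  (koszul_boundary_submod_closed x p).

Definition koszul_homology x p := quotmod (koszul_boundary x p).
HB.instance Definition _ x p := GRing.Lmodule.on (koszul_homology x p).

(* e_s is sent to (\prod_(i in s) x i) e_s. *)
Definition koszul_trans (x : 'I_r -> R) (c : koszul) : koszul :=
  [ffun s : {set 'I_r} => (\prod_(i in s) x i) *: c s].

Lemma koszul_trans_is_linear x : linear (koszul_trans x).
Proof.
move=> a c e; apply/ffunP => t; rewrite !ffunE scalerDr; congr (_ + _).
by rewrite !scalerA mulrC.
Qed.
HB.instance Definition _ x := GRing.isLinear.Build R koszul koszul *:%R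
  (koszul_trans x) (koszul_trans_is_linear x).

Lemma koszul_trans_degree x p c :
  c \in koszul_degree p -> koszul_trans x c \in koszul_degree p.
Proof.
move=> /forallP hc; apply/forallP => s; rewrite !ffunE.
by apply: contraTT (hc s) => /=; rewrite !negb_imply => /andP[h ->];
  rewrite andbT; apply: contraNneq h => ->; rewrite scaler0.
Qed.

Definition seq_pow (x : 'I_r -> R) (n : nat) : 'I_r -> R := fun i => x i ^+ n.

Lemma koszul_trans_diff x n c :
  koszul_diff (seq_pow x n) (koszul_trans x c) =
  koszul_trans x (koszul_diff (seq_pow x n.+1) c).
Proof.
apply/ffunP => t; rewrite !ffunE scaler_sumr; apply: eq_bigr => i it.
rewrite ffunE big_setU1 //= !scalerA /seq_pow exprS; congr (_ *: _).
by rewrite [RHS]mulrC -!mulrA; congr (_ * _); rewrite mulrCA.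
Qed.

Lemma koszul_trans_cycle x n p (z : submod (koszul_cycle (seq_pow x n.+1) p)) :
  koszul_trans x (val z) \in koszul_cycle (seq_pow x n) p.
Proof.
case: z => c /= /andP[hc /eqP dc].
by rewrite inE koszul_trans_degree //= koszul_trans_diff dc raddf0.
Qed.

Definition koszul_cycle_trans x n p (z : submod (koszul_cycle (seq_pow x n.+1) p)) :
  submod (koszul_cycle (seq_pow x n) p) := SubMod (koszul_trans_cycle z).

Definition koszul_homology_trans x n p
    (h : koszul_homology (seq_pow x n.+1) p) : koszul_homology (seq_pow x n) p :=
  quotmod_pi (koszul_boundary (seq_pow x n) p) (koszul_cycle_trans (repr h)).

Lemma koszul_homology_transE x n p (z : submod (koszul_cycle (seq_pow x n.+1) p)) :
  koszul_homology_trans (quotmod_pi (koszul_boundary (seq_pow x n.+1) p) z) =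
  quotmod_pi (koszul_boundary (seq_pow x n) p) (koszul_cycle_trans z).
Proof.
apply/quotmod_eqP.
have /quotmod_eqP/asboolP[b hb db] :
    \pi_(koszul_homology (seq_pow x n.+1) p)
      (repr (quotmod_pi (koszul_boundary (seq_pow x n.+1) p) z)) =
    \pi_(koszul_homology (seq_pow x n.+1) p) z by rewrite reprK.
apply/asboolP; exists (koszul_trans x b); first exact: koszul_trans_degree.
by rewrite koszul_trans_diff db !raddfB.
Qed.

Lemma koszul_homology_trans_is_linear x n p :
  linear (@koszul_homology_trans x n p).
Proof.
move=> a u v; rewrite -[u]reprK -[v]reprK.
rewrite -!/(quotmod_pi _ _) -linearP !koszul_homology_transE -linearP.
by congr quotmod_pi; apply: val_inj; rewrite /= linearP.
Qed.
HB.instance Definition _ x n p := GRing.isLinear.Build R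
  (koszul_homology (seq_pow x n.+1) p) (koszul_homology (seq_pow x n) p) *:%R
  (@koszul_homology_trans x n p) (@koszul_homology_trans_is_linear x n p).

Definition local_homology (x : 'I_r -> R) (p : nat) : lmodType R :=
  @invlim R (fun n => koszul_homology (seq_pow x n) p)
    (fun n => @koszul_homology_trans x n p).

End Koszul.

(* Main.v *)
Require Import Defs.
From HB Require Import structures.
From mathcomp Require Import all_boot all_order all_algebra.
From mathcomp Require Import boolp.

(** In top degree the Koszul homology of X with respect to x_1^n, ..., x_d^n is
    the submodule 0 :_X (x_1^n, ..., x_d^n), and the transition maps become
    multiplication by x_1 ... x_d.  So H, the local homology in degree d, is the
    module of sequences (u_n) in X with x_i^n u_n = 0 for all i and
    (x_1 ... x_d) u_(n+1) = u_n.

    The variables are removed one at a time.  For a set S of indices, [tower S]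
    keeps the powers x_i^n only for i in S, asks that x_i itself kill u_n for
    the other i, and has the product over S as transition map.  Thus
    [tower setT] is H, while [tower set0] consists of constant sequences with
    value in 0 :_X (x_1, ..., x_d), which is finitely generated since it has
    finite length.  For a in S let p be the product of the x_i with i in S and
    i <> a.  The map
        phi : tower S -> tower (S minus a),   phi(u)_n = x_a^n p u_(n+1)
    is the connecting map of the multiplication by x_a on X, and its kernel is
    x_a (tower S): if phi(u) = 0 then w_n = p u_(n+1) lies in [tower S], and
    x_a w = u.  The surjectivity of x_a on X, needed to define the connecting
    map in the usual way, is replaced by the divisibility u_n = x_a (p u_(n+1))
    that is built into the tower.

    By induction on the size of S the image of phi is finitely generated, as R
    is noetherian.  Lifting generators of it gives h in [tower S] with
    tower S = <h> + x_a (tower S).  As R is complete and as [tower S] is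
    x_a-adically separated (its n-th entries are killed by x_a^n), the complete
    form of Nakayama's lemma ([complete_nakayama]) shows that h generates
    [tower S]. *)

Set Implicit Arguments.
Unset Strict Implicit.
Unset Printing Implicit Defensive.

Import GRing.Theory.
Local Open Scope ring_scope.

(** * Finite generation over noetherian rings *)

Section Spans.
Variables (R : comNzRingType).

(** Turns a predicate that depends on local data into a submodule inside a
    proof. *)
Definition submod_of (V : lmodType R) (P : {pred V}) (P_closed : submod_closed P) :
    submodClosed V :=
  HB.pack P (GRing.isSubmodClosed.Build R V P P_closed).

(** A [submodClosed] predicate carries no instance of closure under opposite,
    so [rpredB] does not apply to it. *)
Lemma submodB (V : lmodType R) (N : submodClosed V) (u v : V) :
  u \in N -> v \in N -> u - v \in N.
Proof. by move=> uN vN; rewrite -scaleN1r rpredD ?rpredZ. Qed.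

Definition lspan (V : lmodType R) (s : seq V) : submodClosed V :=
  lin_span (fun i : 'I_(size s) => s`_i).

Definition fg (V : lmodType R) (N : {pred V}) : Prop := exists s, N =i lspan s.

Section OneModule.
Variable V : lmodType R.
Implicit Types (s : seq V) (N : submodClosed V).

Lemma lspan_nil (w : V) : w \in lspan [::] = (w == 0).
Proof.
apply/asboolP/eqP => [[c ->]|->]; first by rewrite big_ord0.
by exists (fun=> 0); rewrite big_ord0.
Qed.

Lemma lspan_consP (u : V) s (w : V) :
  w \in lspan (u :: s) <-> exists a, w - a *: u \in lspan s.
Proof.
split=> [/asboolP[c ->]|[a /asboolP[c def_w]]].
  exists (c ord0); apply/asboolP; exists (fun i => c (lift ord0 i)).
  by rewrite big_ord_recl addrC addKr.
apply/asboolP; exists (fun i => oapp c a (unlift ord0 i)).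
rewrite big_ord_recl unlift_none /=; apply/eqP; rewrite addrC -subr_eq def_w.
by apply/eqP/eq_bigr => i _; rewrite liftK.
Qed.

Lemma sub_lspan_cons (u : V) s : {subset lspan s <= lspan (u :: s)}.
Proof. by move=> w ws; apply/lspan_consP; exists 0; rewrite scale0r subr0. Qed.

Lemma mem_lspan s : {subset s <= lspan s}.
Proof.
elim: s => [|u s IHs] w //; rewrite inE => /predU1P[->|/IHs/sub_lspan_cons //].
by apply/lspan_consP; exists 1; rewrite scale1r subrr rpred0.
Qed.

Lemma lspan_sub s N : {subset s <= N} -> {subset lspan s <= N}.
Proof.
move=> sN w /asboolP[c ->]; apply: rpred_sum => i _.
by rewrite rpredZ // sN // mem_nth.
Qed.

(** Otherwise every list of elements of N spans a proper submodule and can be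
    extended by an element of N outside its span; iterating this gives a
    strictly increasing chain of submodules. *)
Lemma noetherian_fg N : noetherian_module V -> fg N.
Proof.
move=> noethV; apply: contrapT => nfgN.
have grow s : exists u, {subset s <= N} -> u \in N /\ u \notin lspan s.
  have [sN|] := pselect {subset s <= N}; last by exists 0.
  apply: contrapT => none; apply: nfgN; exists s => w.
  apply/idP/idP; last exact: lspan_sub sN w.
  move=> wN; apply: contrapT => /negP ws; by apply: none; exists w.
have [f fP] := choice grow.
pose chain n := iter n (fun s => f s :: s) [::].
have chainN n : {subset chain n <= N}.
  elim: n => [|n IHn] // w; rewrite inE => /predU1P[->|/IHn //].
  by have [] := fP _ IHn.
have [n stab] := noethV (fun n => lspan (chain n))
  (fun n => @sub_lspan_cons (f (chain n)) (chain n)).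
have [_ /negP[]] := fP _ (chainN n).
by rewrite -(stab n.+1 (leqnSn n)) mem_lspan // mem_head.
Qed.

(** One generator per step of a composition series: any element of M_(i+1)
    outside M_i generates M_(i+1) modulo M_i, by maximality of M_i. *)
Lemma finite_length_fg (N : {pred V}) : finite_length N -> fg N.
Proof.
case=> k [M [M0 Mk Mstep]].
suff fgM i : (i <= k)%N -> fg (M i).
  by have [s Ms] := fgM k (leqnn k); exists s => w; rewrite -Mk.
elim: i => [_|i IHi ltik]; first by exists [::] => w; rewrite M0 lspan_nil.
have [s Ms] := IHi (ltnW ltik); have [subM neqM simpleM] := Mstep i ltik.
have [u [uM uNM]] : exists u, u \in M i.+1 /\ u \notin M i.
  apply: contrapT => none; apply: neqM => w; apply/idP/idP; first exact: subM.
  by move=> wM; apply: contrapT => /negP wNM; apply: none; exists w.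
exists (u :: s) => w.
have sub_Mi : {subset M i <= lspan (u :: s)}.
  by move=> z; rewrite Ms; apply: sub_lspan_cons.
have sub_MSi : {subset lspan (u :: s) <= M i.+1}.
  apply: lspan_sub => z; rewrite inE => /predU1P[->//|zs].
  by apply: subM; rewrite Ms mem_lspan.
have [/(_ u)|->//] := simpleM _ sub_Mi sub_MSi.
by rewrite mem_lspan ?mem_head // (negbTE uNM).
Qed.

End OneModule.

Lemma mem_lspan_map (V W : lmodType R) (f : {linear V -> W}) (s : seq V) (w : W) :
  w \in lspan (map f s) <-> exists2 z, z \in lspan s & w = f z.
Proof.
elim: s w => [|u s IHs] w /=.
  rewrite lspan_nil; split=> [/eqP->|[z]]; first by exists 0; rewrite ?lspan_nil ?raddf0.
  by rewrite lspan_nil => /eqP-> ->; rewrite raddf0.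
split=> [/lspan_consP[a /IHs[z zs def_w]]|[z /lspan_consP[a zs] ->]].
  exists (z + a *: u); first by apply/lspan_consP; exists a; rewrite addrK.
  by rewrite linearD linearZZ -def_w subrK.
apply/lspan_consP; exists a; apply/IHs; exists (z - a *: u) => //.
by rewrite linearB [f (a *: u)]linearZZ.
Qed.

Lemma choose_preimages (V : eqType) (W : eqType) (f : V -> W) (T : {pred V})
    (s : seq W) :
  (forall w, w \in s -> exists2 v, v \in T & w = f v) ->
  exists2 h : seq V, {subset h <= T} & s = map f h.
Proof.
elim: s => [|w s IHs] sT; first by exists [::].
have [u uT def_w] := sT w (mem_head w s).
have [z zs|h hT def_s] := IHs; first by apply: sT; rewrite inE zs orbT.
exists (u :: h); last by rewrite /= -def_s -def_w.
by move=> z; rewrite inE => /predU1P[->|/hT].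
Qed.

(** Induction on the number of generators of the ambient
    module: the coefficients of the first generator u in elements of N form a
    finitely generated ideal, and elements of N realizing generators of that
    ideal generate N modulo its intersection with the span of the remaining
    generators. *)
Lemma sub_fg (V : lmodType R) (s : seq V) (N : submodClosed V) :
  noetherian_ring R -> {subset N <= lspan s} -> fg N.
Proof.
move=> noethR; elim: s N => [|u s IHs] N Ns.
  exists [::] => w; apply/idP/idP => [/Ns //|].
  by rewrite lspan_nil => /eqP->; rewrite rpred0.
(* The construction is parametrized by the submodule because it is used for N,
   and then for the span of the elements of N that realize the generators. *)
pose coef_of (N' : submodClosed V) : {pred R^o} :=
  [pred a | `[< exists2 w, w \in N' & w - a *: u \in lspan s >]].
have coef_of_closed N' : submod_closed (coef_of N').
  split; first by apply/asboolP; exists 0; rewrite ?scale0r ?subr0 rpred0.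
  move=> c a b /asboolP[w wN wa] /asboolP[z zN zb]; apply/asboolP.
  exists (c *: w + z); first by rewrite rpredD ?rpredZ.
  have -> : c *: w + z - (c *: a + b) *: u = c *: (w - a *: u) + (z - b *: u).
    by rewrite scalerBr scalerA [in LHS]scalerDl opprD addrACA.
  by rewrite rpredD ?rpredZ.
have [c Ic] := @noetherian_fg _ (submod_of (coef_of_closed N)) noethR.
have rest_closed : submod_closed [pred w | (w \in N) && (w \in lspan s)].
  split; first by rewrite inE !rpred0.
  by move=> a w z /andP[? ?] /andP[? ?]; rewrite inE !(rpredD, rpredZ).
have [t Nt] := IHs (submod_of rest_closed) (fun w wN => proj2 (andP wN)).
(* h lists elements of N, one for each generator of the ideal. *)
have [h hN def_c] : exists2 h : seq V, {subset h <= N} &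
    {subset c <= coef_of (lspan h)}.
  have cN a : a \in c -> exists2 w, w \in N & w - a *: u \in lspan s.
    by move=> /(@mem_lspan R^o); rewrite -Ic => /asboolP.
  elim: (c) cN => [|a c' IHc] cN; first by exists [::].
  have [h hN hc'] := IHc (fun b bc => cN b (@mem_behead _ (a :: c') b bc)).
  have [w wN wa] := cN a (mem_head a c').
  exists (w :: h) => b; rewrite inE => /predU1P[->|] //; first exact: hN.
    by apply/asboolP; exists w => //; rewrite mem_lspan ?mem_head.
  move=> /hc'/asboolP[z zh zb]; apply/asboolP; exists z => //.
  exact: sub_lspan_cons.
exists (h ++ t) => w; apply/idP/idP; last first.
  apply: lspan_sub => z; rewrite mem_cat => /orP[/hN //|/mem_lspan].
  by rewrite -Nt => /andP[].
have sub_cat z : z \in lspan h -> z \in lspan (h ++ t).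
  by apply: lspan_sub => y yh; rewrite mem_lspan // mem_cat yh.
have tcat z : z \in lspan t -> z \in lspan (h ++ t).
  by apply: lspan_sub => y yt; rewrite mem_lspan // mem_cat yt orbT.
move=> wN; have /lspan_consP[a wa] := Ns w wN.
have : a \in submod_of (coef_of_closed N) by apply/asboolP; exists w.
rewrite Ic => /(lspan_sub (N := submod_of (coef_of_closed (lspan h))) def_c).
move=> /asboolP[z zh za]; rewrite -[w](subrK z); apply: rpredD (sub_cat _ zh).
rewrite tcat // -Nt.
apply/andP; split; first by rewrite submodB // (lspan_sub hN).
have -> : w - z = (w - a *: u) - (z - a *: u) by rewrite opprB addrA subrK.
exact: submodB.
Qed.

End Spans.

(** * Nakayama's lemma over complete rings *)

Section Complete.
Variables (R : comNzRingType) (m : submodClosed R^o).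

Lemma ideal_pow_closed n : submod_closed (ideal_pow m n : {pred R^o}).
Proof.
split.
  apply/asboolP; exists 0%N, (fun=> 0), (fun _ _ => 0).
  by split=> [[]//|]; rewrite big_ord0.
move=> a _ _ /asboolP[k [b [c [cm ->]]]] /asboolP[l [e [f [fm ->]]]].
apply/asboolP; exists (k + l)%N,
  (fun j => match split j with inl i => a * b i | inr i => e i end),
  (fun j => match split j with inl i => c i | inr i => f i end).
split=> [j i|]; first by case: splitP => ? _.
rewrite big_split_ord /= scaler_sumr; congr (_ + _).
  by apply: eq_bigr => j _; rewrite (unsplitK (inl j)); apply: mulrA.
by apply: eq_bigr => j _; rewrite (unsplitK (inr j)).
Qed.

Lemma expr_ideal_pow a n : a \in m -> a ^+ n \in ideal_pow m n.
Proof.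
move=> am; apply/asboolP; exists 1%N, (fun=> 1), (fun _ _ => a); split=> //.
by rewrite big_ord1 mul1r prodr_const card_ord.
Qed.

(** b_n is the limit of the power series c_n + c_(n+1) a + c_(n+2) a^2 + ...;
    solving for all the tails at once gives an exact recurrence, hence exact
    divisibility of remainders by a^n, instead of congruences modulo m^n. *)
Lemma complete_power_series (a : R) (c : nat -> R) :
  adic_complete m -> a \in m -> exists b, forall n, b n = c n + a * b n.+1.
Proof.
move=> [sep lim] am.
(* part n N is the sum of the first N terms of the n-th tail. *)
pose part n N := \sum_(j < N) c (n + j)%N * a ^+ j.
have partS n N : part n N.+1 = part n N + c (n + N)%N * a ^+ N.
  exact: big_ord_recr.
have part_rec n N : part n N.+1 = c n + a * part n.+1 N.
  rewrite /part big_ord_recl addn0 mulr1 mulr_sumr; congr (_ + _).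
  by apply: eq_bigr => j _; rewrite /= addnS mulrCA exprS.
have powZ n e u : u \in ideal_pow m n -> e * u \in ideal_pow m n.
  exact: (@rpredZ _ R^o (submod_of (ideal_pow_closed n)) e u).
have powB n u v : u \in ideal_pow m n -> v \in ideal_pow m n ->
    u - v \in ideal_pow m n.
  exact: (@submodB _ R^o (submod_of (ideal_pow_closed n)) u v).
have powD n u v : u \in ideal_pow m n -> v \in ideal_pow m n ->
    u + v \in ideal_pow m n.
  by move=> un /(powZ _ (-1)) vn; rewrite -[v]opprK -[- v]mulN1r powB.
have lim_part n : exists b, forall N, b - part n N \in ideal_pow m N.
  apply: lim => N; rewrite partS addrC addKr.
  by apply/powZ/expr_ideal_pow.
have [b bP] := choice lim_part; exists b => n.
apply/eqP; rewrite -subr_eq0; apply/eqP/sep => N.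
have -> : b n - (c n + a * b n.+1) =
    (b n - part n N) - c (n + N)%N * a ^+ N - a * (b n.+1 - part n.+1 N).
  rewrite mulrBr -[b n - part n N - _]addrA -opprD -partS part_rec opprB.
  by rewrite !opprD !addrA subrK.
by apply/powB/powZ/bP/powB; [exact: bP | exact/powZ/expr_ideal_pow].
Qed.

(** Nakayama's lemma for complete rings.  Expanding u repeatedly as an element
    of the span of h plus a times an element of T yields power series in a as
    coefficients on h; the remainder of u by their sums is divisible by every
    power of a in T, hence is zero. *)
Lemma complete_nakayama (V : lmodType R) (T : submodClosed V) (a : R) (h : seq V) :
  adic_complete m -> a \in m -> {subset h <= T} ->
  (forall u, u \in T -> exists2 z, z \in lspan h &
     exists2 w, w \in T & u = z + a *: w) ->
  (forall u, (forall n, exists2 w, w \in T & u = a ^+ n *: w) -> u = 0) ->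
  T =i lspan h.
Proof.
move=> complR am hT gen sep u; apply/idP/idP; last exact: lspan_sub hT u.
pose comb (c : 'I_(size h) -> R) : V := \sum_(i < size h) c i *: h`_i.
have step u' : exists cw : ('I_(size h) -> R) * V,
    u' \in T -> cw.2 \in T /\ u' = comb cw.1 + a *: cw.2.
  have [uT|uNT] := pselect (u' \in T); last by exists (fun=> 0, 0) => uT; case: uNT.
  have [_ /asboolP[c ->] [w wT ->]] := gen _ uT.
  by exists (c, w).
have [f fP] := choice step.
move=> uT; pose w n := iter n (fun v => (f v).2) u.
have wT n : w n \in T by elim: n => [|n IHn] //; have [] := fP _ IHn.
have wP n : w n = comb (f (w n)).1 + a *: w n.+1 by have [] := fP _ (wT n).
have series i : exists b, forall n, b n = (f (w n)).1 i + a * b n.+1.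
  exact: complete_power_series.
have [b bP] := choice series.
(* w n is the n-th successive remainder, and v n its difference with the
   combination of h given by the n-th tails of the coefficient series; by the
   recurrence, v n is exactly a times v n.+1. *)
pose v n := w n - comb (b^~ n).
have vT n : v n \in T.
  apply: submodB => //; apply: rpred_sum => i _; apply: rpredZ.
  by apply: hT; rewrite mem_nth.
have vS n : v n = a *: v n.+1.
  rewrite /v {1}wP scalerBr [comb (b^~ n)](_ : _ = comb (f (w n)).1 + a *: comb (b^~ n.+1)).
    by rewrite opprD addrACA subrr add0r.
  rewrite /comb scaler_sumr -big_split; apply: eq_bigr => i _ /=.
  by rewrite bP scalerDl scalerA.
have v_pow n : v 0%N = a ^+ n *: v n.
  by elim: n => [|n ->]; rewrite ?scale1r // vS scalerA exprSr.
apply/asboolP; exists (b^~ 0%N); apply/eqP; rewrite -subr_eq0; apply/eqP.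
by apply: (sep (v 0%N)) => n; exists (v n).
Qed.

End Complete.

(** * Towers of annihilators *)

Section Towers.
Variables (R : comNzRingType) (X : lmodType R) (d : nat) (x : 'I_d -> R).
Implicit Types S : {set 'I_d}.

Let sequences : lmodType R := dprod (fun _ => X).

(** The indices outside S are those already specialized to the annihilator of
    x_i; keeping them as conditions on sequences of X makes the induction on S
    take place inside one fixed module. *)
Definition tower S : {pred sequences} :=
  [pred u : sequences | `[< forall n,
     [/\ forall i, i \in S -> x i ^+ n *: u n = 0,
         forall i, i \notin S -> x i *: u n = 0 &
         (\prod_(i in S) x i) *: u n.+1 = u n] >]].

Lemma tower_submod_closed S : submod_closed (tower S).
Proof.
split.
  by apply/asboolP => n; split=> *; apply: scaler0.
move=> a u v /asboolP Su /asboolP Sv; apply/asboolP => n.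
have [uS uNS uT] := Su n; have [vS vNS vT] := Sv n.
have lin (b : R) (y z y' z' : X) : b *: y = y' -> b *: z = z' ->
    b *: (a *: y + z) = a *: y' + z'.
  by move=> <- <-; rewrite scalerDr !scalerA mulrC.
split=> [i iS|i iS|]; last exact: lin uT vT.
  by rewrite (lin _ _ _ _ _ (uS i iS) (vS i iS)) scaler0 addr0.
by rewrite (lin _ _ _ _ _ (uNS i iS) (vNS i iS)) scaler0 addr0.
Qed.
HB.instance Definition _ S :=
  GRing.isSubmodClosed.Build R sequences (tower S) (tower_submod_closed S).

(** Common form of the connecting map phi, with k_n = x_a^n p, and of the
    section w of the multiplication by x_a on its kernel, with k_n = p. *)
Definition shift (k : nat -> R) (u : sequences) : sequences :=
  fun n => k n *: u n.+1.

Lemma shift_is_linear k : linear (shift k).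
Proof.
move=> b u v; apply: functional_extensionality_dep => n.
by rewrite [LHS]scalerDr scalerA mulrC -scalerA.
Qed.
HB.instance Definition _ k := GRing.isLinear.Build R sequences sequences *:%R
  (shift k) (shift_is_linear k).

Section Step.
Variables (S : {set 'I_d}) (a : 'I_d).
Hypothesis aS : a \in S.
Let rest : R := \prod_(i in S :\ a) x i.

Let prodS : \prod_(i in S) x i = x a * rest.
Proof. exact: big_setD1. Qed.

Let kill_rest u n i : u \in tower S -> i \in S -> i != a ->
  x i ^+ n *: (rest *: u n.+1) = 0.
Proof.
move=> /asboolP/(_ n.+1)[uS _ _] iS ia.
rewrite /rest (big_setD1 i) /= ?inE ?ia // scalerA mulrA -exprSr mulrC -scalerA.
by rewrite uS // scaler0.
Qed.

Lemma connecting_tower u : u \in tower S ->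
  shift (fun n => x a ^+ n * rest) u \in tower (S :\ a).
Proof.
move=> uT; have /asboolP uP := uT; apply/asboolP => n; rewrite /shift.
have [uS uNS _] := uP n.+1; have [_ _ uP2] := uP n.+1.
have kill_a : x a *: ((x a ^+ n * rest) *: u n.+1) = 0.
  by rewrite scalerA mulrA -exprS mulrC -scalerA uS // scaler0.
split=> [i|i|].
- rewrite !inE => /andP[ia iS].
  by rewrite -scalerA scalerA mulrC -scalerA kill_rest // scaler0.
- rewrite !inE negb_and negbK => /orP[/eqP->//|iNS].
  by rewrite scalerA mulrC -scalerA uNS // scaler0.
rewrite -uP2 -/rest prodS !scalerA; congr (_ *: _).
by rewrite exprSr mulrCA -!mulrA; congr (_ * _); rewrite mulrCA.
Qed.

(** Since u_n = x_a (p u_(n+1)), the sequence p u_(n+1) divides u by x_a; the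
    vanishing of phi(u) is the condition that x_a^n kill its n-th entry. *)
Lemma connecting_ker u : u \in tower S ->
  shift (fun n => x a ^+ n * rest) u = 0 ->
  exists2 w, w \in tower S & u = x a *: w.
Proof.
move=> uT phi_u; have /asboolP uP := uT.
exists (shift (fun=> rest) u); last first.
  apply: functional_extensionality_dep => n; have [_ _ <-] := uP n.
  by rewrite prodS -scalerA.
apply/asboolP => n; have [_ uNS uP2] := uP n.+1; rewrite /shift.
split=> [i iS|i iNS|].
- have [->|ia] := eqVneq i a; last exact: kill_rest.
  by rewrite scalerA; apply: (f_equal (fun v : sequences => v n) phi_u).
- by rewrite scalerA mulrC -scalerA uNS // scaler0.
by rewrite -uP2 !scalerA mulrC.
Qed.

Lemma tower_separated u :
  (forall n, exists2 w, w \in tower S & u = x a ^+ n *: w) -> u = 0.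
Proof.
move=> div_u; apply: functional_extensionality_dep => n.
have [w /asboolP/(_ n)[wS _ _] ->] := div_u n.
exact: wS.
Qed.

End Step.

Lemma const_tower u : u \in tower set0 ->
  exists2 v, v \in annihilated X (ideal_gen x) & u = (fun=> v).
Proof.
move=> /asboolP uP; have u_const n : u n = u 0%N.
  elim: n => // n <-; have [_ _ <-] := uP n.
  by rewrite big_set0 scale1r.
exists (u 0%N); last exact: functional_extensionality_dep.
apply/asboolP => _ /asboolP[c ->]; rewrite scaler_suml big1 // => i _.
have [_ uN _] := uP 0%N; rewrite -scalerA uN ?inE // scaler0 //.
Qed.

Definition const_seq (v : X) : sequences := fun=> v.
Lemma const_seq_is_linear : linear const_seq.
Proof. by []. Qed.
HB.instance Definition _ := GRing.isLinear.Build R X sequences *:%R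
  const_seq const_seq_is_linear.

Lemma tower_fg (m : submodClosed R^o) S :
  noetherian_ring R -> adic_complete m -> (forall i, x i \in m) ->
  fg (annihilated X (ideal_gen x)) -> fg (tower S).
Proof.
move=> noethR complR xm [s Hs].
elim: {S}#|S| {-2}S (erefl #|S|) => [|n IHn] S cardS.
  move/eqP: cardS; rewrite cards_eq0 => /eqP->.
  apply: (@sub_fg _ _ (map const_seq s)) => // u /const_tower[v].
  by rewrite Hs => vs ->; apply/mem_lspan_map; exists v.
have [a aS] : exists a, a \in S.
  by apply/set0Pn; rewrite -cards_eq0 cardS.
have [t Ht] : fg (tower (S :\ a)).
  by apply: IHn; move: cardS; rewrite (cardsD1 a) aS => -[].
pose k n := x a ^+ n * \prod_(i in S :\ a) x i.
have im_closed : submod_closed [pred v | `[< exists2 u, u \in tower S & v = shift k u >]].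
  split; first by apply/asboolP; exists 0; rewrite ?rpred0 // raddf0.
  move=> b _ _ /asboolP[u uT ->] /asboolP[v vT ->]; apply/asboolP.
  by exists (b *: u + v); rewrite ?linearP // rpredD ?rpredZ.
(* im generates the image of the connecting map; h lifts it to the tower. *)
have [im def_im] : fg (submod_of im_closed).
  apply: (@sub_fg _ _ t) => // _ /asboolP[u uT ->].
  by rewrite -Ht; apply: connecting_tower.
have [h hT def_h] : exists2 h, {subset h <= tower S} & im = map (shift k) h.
  apply: choose_preimages => v /mem_lspan; rewrite -def_im => /asboolP[u uT ->].
  by exists u.
exists h; apply: (complete_nakayama complR (xm a) hT) => [u uT|u].
  have : shift k u \in lspan im by rewrite -def_im; apply/asboolP; exists u.
  rewrite def_h => /mem_lspan_map[z zh phi_uz]; exists z => //.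
  have zT := lspan_sub hT zh.
  have [|w wT def_w] := connecting_ker aS (submodB uT zT).
    by rewrite raddfB; apply/eqP; rewrite subr_eq0; apply/eqP.
  by exists w; rewrite // -def_w addrC subrK.
exact: tower_separated.
Qed.

End Towers.

(** * Top Koszul homology as a tower *)

Definition invlim_of (R : comNzRingType) (V : nat -> lmodType R)
    (f : forall n, {linear V n.+1 -> V n}) (u : dprod V)
    (u_compat : forall n, f n (u n.+1) = u n) : invlim f :=
  SubMod (introT (asboolP (forall n, f n (u n.+1) = u n)) u_compat
          : u \in compatible f).

Section TopKoszul.
Variables (R : comNzRingType) (X : lmodType R) (d : nat).

(** The chain v e_1 /\ ... /\ e_d. *)
Definition top_chain (v : X) : koszul X d :=
  [ffun s : {set 'I_d} => if s == setT then v else 0].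

Lemma top_chain_is_linear : linear top_chain.
Proof.
by move=> a u v; apply/ffunP => s; rewrite !ffunE; case: eqP; rewrite // scaler0 addr0.
Qed.
HB.instance Definition _ :=
  GRing.isLinear.Build R X (koszul X d) *:%R top_chain top_chain_is_linear.

Lemma top_chain_cycle (y : 'I_d -> R) (v : X) :
  (forall i, y i *: v = 0) -> top_chain v \in koszul_cycle y d.
Proof.
move=> yv; apply/andP; split.
  apply/forallP => s; rewrite ffunE; have [->|_] := eqVneq s setT.
    by rewrite cardsT card_ord eqxx implybT.
  by rewrite eqxx.
apply/eqP/ffunP => t; rewrite !ffunE big1 // => i _; rewrite ffunE.
by case: eqP => _; rewrite ?scaler0 // -scalerA yv scaler0.
Qed.

(** The coefficient of the boundary of c at the complement of i is, up to
    sign, y_i times the only coefficient of c. *)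
Lemma top_cycleP (y : 'I_d -> R) (c : koszul X d) :
  c \in koszul_cycle y d -> c = top_chain (c setT) /\ forall i, y i *: c setT = 0.
Proof.
case/andP=> /forallP c_deg /eqP dc0.
have c_top s : s != setT -> c s = 0.
  move=> sT; apply/eqP; move: (c_deg s); apply: contraLR => cs.
  rewrite cs /=; apply: contra sT => /eqP sd.
  by rewrite eqEcard subsetT cardsT card_ord sd /=.
split; first by apply/ffunP => s; rewrite ffunE; case: eqVneq => [->//|/c_top].
move=> i; have := f_equal (fun e : koszul X d => e (~: [set i])) dc0.
rewrite !ffunE (big_pred1 i) => [|j]; last by rewrite !inE negbK.
(* Multiplying once more by the sign cancels it. *)
rewrite setUCr -scalerA => /(f_equal (fun v => (-1) ^+ #|[set j in ~: [set i] | (j < i)%N]| *: v)).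
by rewrite scalerA -expr2 sqrr_sign scale1r scaler0.
Qed.

(** There are no nonzero chains in degree d + 1. *)
Lemma top_boundary0 (y : 'I_d -> R) (z : submod (koszul_cycle (X := X) y d)) :
  z \in @koszul_boundary R X d y d -> z = 0.
Proof.
case/asboolP=> b /forallP b_deg db; apply: val_inj; rewrite -db.
rewrite (_ : b = 0) ?raddf0 //; apply/ffunP => s; rewrite ffunE; apply/eqP.
apply: contraTT (b_deg s) => bs; rewrite bs /=.
by rewrite neq_ltn ltnS -[X in (_ <= X)%N](card_ord d) max_card.
Qed.

Variable x : 'I_d -> R.

Lemma tower_entry_cycle (u : submod (tower (X := X) x setT)) n :
  top_chain (val u n) \in koszul_cycle (seq_pow x n) d.
Proof.
case: u => u /= /asboolP/(_ n)[uS _ _]; apply: top_chain_cycle => i.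
by apply: uS; rewrite inE.
Qed.

Definition tower_class (u : submod (tower (X := X) x setT)) :
    dprod (fun n => koszul_homology X (seq_pow x n) d) :=
  fun n => quotmod_pi (@koszul_boundary R X d (seq_pow x n) d) (SubMod (tower_entry_cycle u n)).

Lemma tower_class_compatible u n :
  koszul_homology_trans (tower_class u n.+1) = tower_class u n.
Proof.
rewrite /tower_class koszul_homology_transE.
congr quotmod_pi; apply: val_inj => /=; apply/ffunP => s; rewrite !ffunE.
case: eqP => [->|_]; last by rewrite scaler0.
by case: u => u /= /asboolP/(_ n)[_ _ <-].
Qed.

Definition tower_homology (u : submod (tower (X := X) x setT)) :
  local_homology X x d := invlim_of (tower_class_compatible u).

Lemma tower_homology_is_linear : linear tower_homology.
Proof.
move=> a u v; apply: val_inj; apply: functional_extensionality_dep => n.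
rewrite [RHS](_ : _ = a *: tower_class u n + tower_class v n) //.
rewrite /= /tower_class -linearP; congr quotmod_pi; apply: val_inj => /=.
exact: linearP.
Qed.
HB.instance Definition _ := GRing.isLinear.Build R
  (submod (tower (X := X) x setT)) (local_homology X x d) *:%R
  tower_homology tower_homology_is_linear.

Lemma tower_homology_surj (h : local_homology X x d) : exists u, tower_homology u = h.
Proof.
case: h => h h_comp.
pose c n : koszul X d := val (repr (h n)).
have cP n : c n = top_chain (c n setT) /\ forall i, seq_pow x n i *: c n setT = 0.
  exact: top_cycleP (valP (repr (h n))).
have uT : (fun n => c n setT) \in tower x setT.
  apply/asboolP => n; split=> [i _|i|]; first by have [_] := cP n; apply.
    by rewrite inE.
  have /asboolP/(_ n) := h_comp.
  rewrite -[RHS]reprK => /quotmod_eqP/top_boundary0/eqP.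
  rewrite subr_eq0 => /eqP/(f_equal (fun z => (submod_val z : koszul X d) setT)).
  by rewrite /= ffunE.
exists (SubMod uT); apply: val_inj; apply: functional_extensionality_dep => n.
rewrite /= /tower_class -[RHS]reprK; congr quotmod_pi; apply: val_inj => /=.
by have [<-] := cP n.
Qed.

End TopKoszul.

Lemma fg_submodule_type (R : comNzRingType) (V : lmodType R) (N : submodClosed V) :
  fg N -> exists s : seq (submod N), forall w, w \in lspan s.
Proof.
case=> s Ns.
have [h _ def_s] : exists2 h : seq (submod N), {subset h <= predT} & s = map val h.
  apply: choose_preimages => w /mem_lspan; rewrite -Ns => wN.
  by exists (SubMod wN).
exists h => w; have : val w \in lspan s by rewrite -Ns (valP w).
by rewrite def_s => /mem_lspan_map[z zh /val_inj->].
Qed.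

Theorem theorem1 (R : comNzRingType) (m : submodClosed R^o) (X : lmodType R)
    (d : nat) (x : 'I_d -> R) :
  noetherian_ring R ->
  local_ring m ->
  adic_complete m ->
  artinian_module X ->
  noetherian_dim m X d%:Z ->
  (forall i, x i \in m) ->
  finite_length (annihilated X (ideal_gen x)) ->
  finitely_generated (local_homology X x d).
Proof.
move=> noethR _ complR _ _ xm lenX.
have [s s_span] := fg_submodule_type (tower_fg setT noethR complR xm (finite_length_fg lenX)).
pose g := map (@tower_homology R X d x) s.
exists (size g), (fun i => g`_i) => h; have [u <-] := tower_homology_surj h.
by apply/(mem_lspan_map (@tower_homology R X d x)); exists u.
Qed.
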